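(* Let $b$ be a geometric structure on a manifold $M$, such that the associated $b$-bracket is positive definite or negative definite. Then for any $F\in\mathcal{C}^{\infty}(M,\mathbb{R})$, neither of the vector fields $\nabla_{b}^{L}F$ and $\nabla_{b}^{R}F$ admits non-trivial periodic orbits.
   Context: All manifolds are connected, Hausdorff, paracompact and smooth; all maps are smooth. A geometric structure on $M$ is a non-degenerate $(0,2)$-tensor field $b:\mathfrak{X}(M)\times\mathfrak{X}(M)\to\mathcal{C}^{\infty}(M,\mathbb{R})$ (no symmetry is assumed). For a smooth function $F$, the left-gradient $\nabla^{L}_{b}F$ and the right-gradient $\nabla^{R}_{b}F$ are the vector fields uniquely defined by $b(\nabla^{L}_{b}F,X)=\mathrm{d}F\cdot X$ and $b(X,\nabla^{R}_{b}F)=\mathrm{d}F\cdot X$ for all $X\in\mathfrak{X}(M)$. The $b$-bracket is $\{F,G\}_b:=b(\nabla_{b}^{L}F,\nabla_{b}^{L}G)=b(\nabla_{b}^{R}F,\nabla_{b}^{R}G)$ (the two expressions agree). With $\operatorname{Crit}(F)=\{m\in M\mid \mathrm{d}F_m=0\}$, the $b$-bracket is called positive definite if $\{F,F\}_b(m)>0$ for all $F\in\mathcal{C}^{\infty}(M,\mathbb{R})$ and all $m\in M\setminus\operatorname{Crit}(F)$, and negative definite if $\{F,F\}_b(m)<0$ for all $F\in\mathcal{C}^{\infty}(M,\mathbb{R})$ and all $m\in M\setminus\operatorname{Crit}(F)$. A non-trivial periodic orbit is a periodic solution of the vector field that is not constant. *)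

(* Defs.v *)
From HB Require Import structures.
From mathcomp Require Import all_boot all_order all_algebra.
From mathcomp Require Import all_classical all_reals all_analysis.
Set Implicit Arguments.
Unset Strict Implicit.
Unset Printing Implicit Defensive.
Import Order.TTheory GRing.Theory Num.Theory.
Import numFieldNormedType.Exports.
Local Open Scope classical_set_scope.
Local Open Scope ring_scope.

(* [U] is always an open set below, so the values of [f] outside [U] do not
   matter. *)
Fixpoint Ck_on (R : realType) (V W : normedModType R) (k : nat) (U : set V)
    (f : V -> W) : Prop :=
  match k with
  | 0 => forall x, U x -> {for x, continuous f}
  | k'.+1 => (forall x, U x -> differentiable f x) /\
             forall v, Ck_on k' U (fun x => 'D_v f x)
  end.

Definition smooth_on (R : realType) (V W : normedModType R) (U : set V)
    (f : V -> W) : Prop :=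
  forall k, Ck_on k U f.

Definition paracompact (T : topologicalType) : Prop :=
  forall U : set (set T),
    (forall A, U A -> open A) -> \bigcup_(A in U) A = [set: T] ->
  exists V : set (set T),
    [/\ forall B, V B -> open B,
        \bigcup_(B in V) B = [set: T],
        forall B, V B -> exists2 A, U A & B `<=` A &
        forall x : T, exists2 N, nbhs x N &
          finite_set [set B | V B /\ B `&` N !=set0]].

(* A homeomorphism [phi] from the open set [dom] onto an open set of R^n, with
   inverse [psi]; both maps are total, with irrelevant values outside [dom] and
   [phi @` dom]. *)
Record chart (R : realType) (n : nat) (T : topologicalType) := Chart {
  dom : set T;
  phi : T -> 'rV[R]_n;
  psi : 'rV[R]_n -> T;
  open_dom : open dom;
  open_cod : open (phi @` dom);
  phiK : forall p, dom p -> psi (phi p) = p;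
  phi_continuous : forall p, dom p -> {for p, continuous phi};
  psi_continuous : forall x, (phi @` dom) x -> {for x, continuous psi} }.

(* [chart_at p] is an arbitrary preferred chart around [p]. It only serves to
   name tangent vectors at [p], see [tangent]. *)
Record manifold (R : realType) (n : nat) := Manifold {
  carrier :> topologicalType;
  atlas : set (chart R n carrier);
  chart_at : carrier -> chart R n carrier;
  chart_at_atlas : forall p, atlas (chart_at p);
  dom_chart_at : forall p, dom (chart_at p) p;
  atlas_compatible : forall c c', atlas c -> atlas c' ->
    smooth_on (phi c @` (dom c `&` dom c')) (phi c' \o psi c);
  manifold_hausdorff : hausdorff_space carrier;
  manifold_connected : connected [set: carrier];
  manifold_paracompact : paracompact carrier }.

(* A tangent vector at [p] is a class of pairs (chart around [p], vector of
   R^n), two pairs being identified when they correspond to each other under the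
   differential of the transition map. It is represented by its unique
   representative in the chart [chart_at p]. *)
Definition tangent (R : realType) (n : nat) (M : manifold R n) (p : M) : Type :=
  'rV[R]_n.

(* The components of a tangent vector in an arbitrary chart [c] around [p]. *)
Definition components (R : realType) (n : nat) (M : manifold R n)
    (c : chart R n M) (p : M) (v : tangent p) : 'rV[R]_n :=
  'd (phi c \o psi (chart_at p)) (phi (chart_at p) p) v.

Record smooth_function (R : realType) (n : nat) (M : manifold R n) :=
  SmoothFunction {
  function_of :> M -> R;
  function_smooth : forall c, atlas c ->
    smooth_on (W := R) (phi c @` dom c) (function_of \o psi c) }.

Record vector_field (R : realType) (n : nat) (M : manifold R n) :=
  VectorField {
  field_of :> forall p : M, tangent p;
  field_smooth : forall c, atlas c ->
    smooth_on (phi c @` dom c)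
      (fun x => components c (field_of (psi c x))) }.

Section vector_field_choice.
Variables (R : realType) (n : nat) (M : manifold R n).

Lemma Ck_on_cst (V W : normedModType R) (k : nat) (U : set V) (a : W) :
  Ck_on k U (fun=> a).
Proof.
elim: k a => [|k IHk] a /=; first by move=> x _; exact: cvg_cst.
split=> [x _|v]; first exact: differentiable_cst.
have -> : (fun x => 'D_v (fun=> a) x) = (fun=> 0 : W).
  by apply/funext => x; rewrite derive_cst.
exact: IHk.
Qed.

Lemma zero_field_smooth (c : chart R n M) : atlas c ->
  smooth_on (phi c @` dom c)
    (fun x => components c (0 : tangent (psi c x))).
Proof.
move=> _ k.
have -> : (fun x => components c (0 : tangent (psi c x))) = (fun=> 0).
  by apply/funext => x; rewrite /components linear0.
exact: Ck_on_cst.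
Qed.

Definition zero_field : vector_field M :=
  VectorField (field_of := fun p => 0 : tangent p) zero_field_smooth.

HB.instance Definition _ := gen_eqMixin (vector_field M).
HB.instance Definition _ := gen_choiceMixin (vector_field M).

End vector_field_choice.

Arguments zero_field {R n M}.

Definition differential (R : realType) (n : nat) (M : manifold R n)
    (F : smooth_function M) (p : M) (v : tangent p) : R :=
  'd (F \o psi (chart_at p) : _ -> R) (phi (chart_at p) p) v.

Definition Crit (R : realType) (n : nat) (M : manifold R n)
    (F : smooth_function M) : set M :=
  [set p | forall v : tangent p, differential F v = 0].

(* In finite dimension either half of non-degeneracy implies the other. *)
Record geometric_structure (R : realType) (n : nat) (M : manifold R n) :=
  GeometricStructure {
  form : forall p : M, {biscalar tangent p};
  form_smooth : forall (X Y : vector_field M) (c : chart R n M), atlas c ->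
    smooth_on (W := R) (phi c @` dom c)
      ((fun p => form p (X p) (Y p)) \o psi c);
  form_nondegl : forall (p : M) (v : tangent p),
    (forall w : tangent p, form p v w = 0) -> v = 0;
  form_nondegr : forall (p : M) (w : tangent p),
    (forall v : tangent p, form p v w = 0) -> w = 0 }.

Section bracket.
Variables (R : realType) (n : nat) (M : manifold R n).
Variable b : geometric_structure M.

Definition eval_form (X Y : vector_field M) : smooth_function M :=
  SmoothFunction (form_smooth b X Y).

Definition is_left_gradient (F : smooth_function M) (V : vector_field M) :=
  forall (X : vector_field M) (p : M),
    eval_form V X p = differential F (X p).

Definition is_right_gradient (F : smooth_function M) (V : vector_field M) :=
  forall (X : vector_field M) (p : M),
    eval_form X V p = differential F (X p).

(* The left and right gradients exist and are unique because [b] is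
   non-degenerate, so the default value [zero_field] is never used. *)
Definition left_gradient (F : smooth_function M) : vector_field M :=
  xget zero_field [set V | is_left_gradient F V].

Definition right_gradient (F : smooth_function M) : vector_field M :=
  xget zero_field [set V | is_right_gradient F V].

(* The right gradients give the same function, since
   b(LF, LG) = dF(LG) = b(LG, RF) = dG(RF) = b(RF, RG). *)
Definition bracket (F G : smooth_function M) : smooth_function M :=
  eval_form (left_gradient F) (left_gradient G).

Definition positive_definite : Prop :=
  forall (F : smooth_function M) (p : M), ~ Crit F p -> 0 < bracket F F p.

Definition negative_definite : Prop :=
  forall (F : smooth_function M) (p : M), ~ Crit F p -> bracket F F p < 0.

End bracket.

Section periodic_orbit.
Variables (R : realType) (n : nat) (M : manifold R n).

(* The derivative of [g] at [t], expressed in the chart [chart_at (g t)], is a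
   tangent vector at [g t]. *)
Definition integral_curve (X : vector_field M) (g : R -> M) : Prop :=
  continuous g /\
  forall t : R, is_derive t 1 (phi (chart_at (g t)) \o g) (X (g t)).

Definition nontrivial_periodic_orbit (X : vector_field M) (g : R -> M) : Prop :=
  [/\ integral_curve X g,
      exists2 T : R, 0 < T & forall t, g (t + T) = g t &
      ~ exists p, forall t, g t = p].

End periodic_orbit.

(* Main.v *)
Require Import Defs.
From HB Require Import structures.
From mathcomp Require Import all_boot all_order all_algebra.
From mathcomp Require Import ring.
From mathcomp Require Import all_classical all_reals all_analysis.

(** Along an integral curve g of X = LF or X = RF, the derivative of F o g is
    dF(X), which equals the bracket {F, F}: for the left gradient
    dF(LF) = b(LF, LF) by definition, and for the right gradient
    dF(RF) = b(LF, RF) = dF(LF) ([right_gradient_bracket]). By definiteness it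
    has a constant sign and vanishes only at critical points of F. So F o g is monotone; if g is
    periodic it is constant, and g runs through critical points of F. There X
    pairs to 0 with every vector, on one side of b, so X = 0 by non-degeneracy
    ([left_gradient_Crit], [right_gradient_Crit]). Since X vanishes along g, the
    curve g does not move ([no_periodic_orbit]).

    The analytic content lies in two existence results. The gradients are
    characterized by pairing with global vector fields, so non-degeneracy at a
    point requires every tangent vector to be the value of a global smooth field
    ([tangent_extension]). And a curve with zero velocity is shown to be
    constant by observing that every smooth function is constant along it, which
    suffices because smooth functions separate points ([separating_function]).
    Both objects are extensions by zero of objects supported in one chart, which
    are smooth because compact sets of a Hausdorff space are closed
    ([smooth_extension]); they are built from a bump function on R^n, itself
    obtained from exp (-1/x), using the stability of C^k maps under sums,
    products and composition ([Ck_on_comp]). *)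

Set Implicit Arguments.
Unset Strict Implicit.
Unset Printing Implicit Defensive.
Import Order.TTheory GRing.Theory Num.Theory.
Import numFieldNormedType.Exports.
Local Open Scope classical_set_scope.
Local Open Scope ring_scope.

(** * Calculus of C^k maps *)

Section Ck_calculus.
Variables (R : realType) (V : normedModType R).

(** The differential is an arbitrarily chosen linear map satisfying the first
    order expansion, so replacing [f] by a function with the same germ requires
    showing that [g] admits that expansion with the differential of [f]. *)
Lemma near_eq_differentiable (W : normedModType R) (f g : V -> W) (x : V) :
  (\near x, f x = g x) -> differentiable f x -> differentiable g x.
Proof.
move=> fg df; have fgx : f x = g x := nbhs_singleton fg.
have gE : g \o shift x = cst (g x) + 'd f x +o_ 0 id.
  apply/eqaddoP => e e0; have /eqaddoP/(_ e e0) := diff_locally df.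
  have fgs : \forall h \near (0 : V), f (h + x) = g (h + x).
    by move: fg; rewrite (near_shift 0) subr0.
  apply: filterS2 fgs => h /= fgh.
  by rewrite !fctE /= fgh fgx.
have dgE : 'd g x = 'd f x :> (V -> W).
  exact: (diff_unique (diff_continuous df) gE).
apply/diff_locallyP; rewrite dgE; split=> //.
exact: (diff_continuous df).
Qed.

(** C^k regularity is local; on a manifold this lets an extension by zero be
    treated separately inside a chart and away from the support. *)
Lemma Ck_on_bigcup (W : normedModType R) k (U : set V) (f : V -> W) :
  (forall x, U x -> exists2 U', U' x & Ck_on k U' f) -> Ck_on k U f.
Proof.
elim: k f => [|k IHk] f Uf /=; first by move=> x /Uf[U' U'x]; exact.
split=> [x /Uf[U' U'x [df _]]|v]; first exact: df.
by apply: IHk => x /Uf[U' U'x [_ Df]]; exists U'; last exact: Df.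
Qed.

Lemma Ck_onW (W : normedModType R) k (U : set V) (f : V -> W) :
  Ck_on k.+1 U f -> Ck_on k U f.
Proof.
elim: k f => [|k IHk] f [df Df]; last by split=> // v; exact: IHk.
by move=> x Ux; exact: differentiable_continuous (df x Ux).
Qed.

(** Openness of [U] matters: a derivative at a point of [U] depends on the
    values in a whole neighbourhood. *)
Lemma Ck_on_eq (W : normedModType R) k (U : set V) (f g : V -> W) :
  open U -> (forall x, U x -> f x = g x) -> Ck_on k U f -> Ck_on k U g.
Proof.
move=> oU; elim: k f g => [|k IHk] f g fg /=.
  move=> cf x Ux.
  have fgx : \near x, f x = g x by near do apply: fg; exact: open_nbhs_nbhs.
  rewrite /prop_for /continuous_at -(fg _ Ux).
  apply: cvg_trans (cf x Ux); apply: near_eq_cvg; exact: fgx.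
have nfg x : U x -> \near x, f x = g x.
  by move=> Ux; near do apply: fg; exact: open_nbhs_nbhs.
move=> [df Df]; split=> [x Ux|v].
  exact: near_eq_differentiable (nfg x Ux) (df x Ux).
by apply: IHk (Df v) => x Ux; exact/near_eq_derive/nfg.
Unshelve. all: by end_near. Qed.

Lemma Ck_on_id k (U : set V) : Ck_on k U (@idfun V).
Proof.
case: k => [|k] /=; first by move=> x _; exact: cvg_id.
split=> // v; have -> : (fun x => 'D_v (@idfun V) x) = cst v.
  by apply/funext => x; rewrite derive_id.
exact: Ck_on_cst.
Qed.

Lemma Ck_onD (W : normedModType R) k (U : set V) (f g : V -> W) : open U ->
  Ck_on k U f -> Ck_on k U g -> Ck_on k U (f + g).
Proof.
move=> oU; elim: k f g => [|k IHk] f g /=.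
  by move=> cf cg x Ux; apply: continuousD; [exact: cf|exact: cg].
move=> [df Df] [dg Dg]; split=> [x Ux|v].
  by apply: differentiableD; [exact: df|exact: dg].
apply: (@Ck_on_eq _ _ _ (fun x => 'D_v f x + 'D_v g x))
  (IHk _ _ (Df v) (Dg v)) => //.
by move=> x Ux; rewrite deriveD//; apply: diff_derivable; [exact: df|exact: dg].
Qed.

Lemma Ck_on_sum (W : normedModType R) k (U : set V) m (f : 'I_m -> V -> W) :
  open U -> (forall i, Ck_on k U (f i)) -> Ck_on k U (\sum_(i < m) f i).
Proof.
move=> oU cf; elim/big_ind : _ => [|g h|i _]; first exact: Ck_on_cst.
  exact: Ck_onD.
exact: cf.
Qed.

Lemma Ck_onM k (U : set V) (f g : V -> R) : open U ->
  Ck_on k U f -> Ck_on k U g -> Ck_on k U (f * g).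
Proof.
move=> oU; elim: k f g => [|k IHk] f g.
  by move=> cf cg x Ux; apply: continuousM; [exact: cf|exact: cg].
move=> cf cg; have [df Df] := cf; have [dg Dg] := cg; split=> [x Ux|v].
  by apply: differentiableM; [exact: df|exact: dg].
apply: (@Ck_on_eq _ _ _
  (f * (fun x => 'D_v g x) + g * (fun x => 'D_v f x))) => //.
  move=> x Ux.
  by rewrite deriveM//; apply: diff_derivable; [exact: df|exact: dg].
by apply: Ck_onD => //; apply: IHk;
  [exact: Ck_onW cf|exact: Dg|exact: Ck_onW cg|exact: Df].
Qed.

Lemma Ck_on_linear (V' W : normedModType R) k (U : set V) (f : V -> V')
    (l : {linear V' -> W}) : open U -> continuous l ->
  Ck_on k U f -> Ck_on k U (l \o f).
Proof.
move=> oU cl; elim: k f => [|k IHk] f /=.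
  by move=> cf x Ux; apply: continuous_comp; [exact: cf|exact: cl].
have dl x : differentiable l x by exact: linear_differentiable.
move=> [df Df]; split=> [x Ux|v].
  exact: differentiable_comp (df x Ux) (dl _).
apply: (@Ck_on_eq _ _ _ (l \o (fun x => 'D_v f x))) (IHk _ (Df v)) => //.
move=> x Ux; have dfx : differentiable f x by exact: df.
rewrite /= !deriveE//; last exact: differentiable_comp (df x Ux) (dl _).
by rewrite [in RHS]diff_comp//= (diff_lin _ cl).
Qed.

(** By induction on the chain rule. In coordinates [l] dual to a basis [e] of
    the intermediate space, D_v (f o t) is the sum over i of the products of
    l_i (D_v t) and (D_(e_i) f) o t, so only products and directional derivatives
    of [f] in fixed directions occur, to which the induction applies. *)
Lemma Ck_on_comp (V' : normedModType R) m (e : 'I_m -> V')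
    (l : 'I_m -> {linear V' -> R}) k (U : set V) (U' : set V') (f : V' -> R)
    (t : V -> V') :
  (forall i, continuous (l i)) -> (forall v, v = \sum_i l i v *: e i) ->
  open U -> (forall x, U x -> U' (t x)) ->
  Ck_on k U t -> Ck_on k U' f -> Ck_on k U (f \o t).
Proof.
move=> cl el oU tU; elim: k f => [|k IHk] f.
  by move=> ct cf x Ux; apply: continuous_comp; [exact: ct|exact/cf/tU].
move=> ct cf; have [dt Dt] := ct; have [df Df] := cf; split=> [x Ux|v].
  by apply: differentiable_comp; [exact: dt|exact/df/tU].
pose g i := (l i \o (fun x => 'D_v t x)) * ((fun y => 'D_(e i) f y) \o t).
apply: (@Ck_on_eq _ _ _ (\sum_i g i)) => // [x Ux|].
  have dfx : differentiable f (t x) by exact/df/tU.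
  have dtx : differentiable t x by exact: dt.
  have -> : 'D_v (f \o t) x = 'd f (t x) ('D_v t x).
    rewrite (deriveE _ (differentiable_comp dtx dfx)) (deriveE _ dtx).
    by rewrite (diff_comp dtx dfx).
  rewrite [in RHS](el ('D_v t x)) linear_sum fct_sumE.
  apply: eq_bigr => i _; rewrite linearZ /g fctE /=; congr (_ * _).
  by rewrite (deriveE _ dfx).
apply: Ck_on_sum => // i; apply: Ck_onM => //.
  exact: Ck_on_linear (Dt v).
by apply: IHk; [exact: Ck_onW|exact: Df].
Qed.

End Ck_calculus.

Section Ck_coordinates.
Variables (R : realType) (V : normedModType R) (n : nat).

Definition coordinate (i : 'I_n) (v : 'rV[R]_n) : R := v 0 i.

Fact coordinate_is_linear i : linear (coordinate i).
Proof. by move=> a u v; rewrite /coordinate !mxE. Qed.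

HB.instance Definition _ i :=
  GRing.isLinear.Build R 'rV[R]_n R _ (coordinate i) (coordinate_is_linear i).

Lemma continuous_coordinate i : continuous (coordinate i).
Proof. exact: coord_continuous. Qed.

Lemma Ck_on_rV k (U : set V) (f : V -> 'rV[R]_n) : open U ->
  (forall i, Ck_on k U (coordinate i \o f)) -> Ck_on k U f.
Proof.
move=> oU cf.
pose e i : R -> 'rV[R]_n := *:%R^~ (delta_mx 0 i).
have e_linear i : linear (e i) by move=> a u v; rewrite /e scalerDl scalerA.
pose el i : {linear R -> 'rV[R]_n} :=
  HB.pack (e i) (GRing.isLinear.Build _ _ _ _ _ (e_linear i)).
have -> : f = \sum_i (el i \o (coordinate i \o f)).
  by apply/funext => x; rewrite fct_sumE {1}[f x]row_sum_delta.
apply: Ck_on_sum => // i; apply: Ck_on_linear (cf i) => //.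
exact: scalel_continuous.
Qed.

Lemma Ck_on_comp_rV k (U : set V) (U' : set 'rV[R]_n) (f : 'rV[R]_n -> R)
    (t : V -> 'rV[R]_n) :
  open U -> (forall x, U x -> U' (t x)) ->
  Ck_on k U t -> Ck_on k U' f -> Ck_on k U (f \o t).
Proof.
apply: (@Ck_on_comp _ _ _ _ (fun i => delta_mx 0 i) coordinate).
  exact: continuous_coordinate.
exact: row_sum_delta.
Qed.

Lemma Ck_on_comp_real k (U : set V) (U' : set R) (f : R -> R) (t : V -> R) :
  open U -> (forall x, U x -> U' (t x)) ->
  Ck_on k U t -> Ck_on k U' f -> Ck_on k U (f \o t).
Proof.
apply: (@Ck_on_comp R V R 1 (fun=> 1) (fun=> idfun)) => [_ x|v].
  exact: cvg_id.
by rewrite big_ord1 /= [_ *: _]mulr1.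
Qed.

End Ck_coordinates.

(** * A function flat at the origin *)

Section flat.
Variable R : realType.

(** The family over all [m], rather than exp (-1/x) alone, is stable under
    differentiation up to linear combinations; this makes the smoothness proof
    an induction. *)
Definition flat (m : nat) (x : R) : R :=
  if 0 < x then x^-1 ^+ m * expR (- x^-1) else 0.

Lemma exprn_le_expR (k : nat) (y : R) :
  0 <= y -> y ^+ k.+1 <= k.+1`!%:R * expR y.
Proof.
move=> y0; rewrite mulrC -ler_pdivrMr ?ltr0n ?fact_gt0//.
by apply: le_trans (expR_ge1Dxn k y0); rewrite lerDr.
Qed.

(** With y = 1/x this is y^(m+2) e^(-y) <= (m+2)!. The square on the right is
    what gives a zero derivative at the origin. *)
Lemma flat_le (m : nat) (x : R) : `|flat m x| <= m.+2`!%:R * x ^+ 2.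
Proof.
rewrite /flat; case: ifPn => [x0|_]; last first.
  by rewrite normr0 mulr_ge0// sqr_ge0.
have y0 : 0 < x^-1 by rewrite invr_gt0.
rewrite ger0_norm; last by rewrite mulr_ge0 ?expR_ge0// exprn_ge0// ltW.
rewrite -[leRHS]mulr1 -[X in _ <= _ * X](expRxMexpNx_1 x^-1) mulrA.
rewrite ler_wpM2r ?expR_ge0//.
rewrite mulrAC -ler_pdivrMr ?exprn_gt0// -exprVn -exprD addn2.
exact/exprn_le_expR/ltW.
Qed.

Lemma is_derive_flat (m : nat) (x : R) :
  is_derive x 1 (flat m) (flat m.+2 x - m%:R * flat m.+1 x).
Proof.
have [x0|x0|->] := ltgtP x 0.
- have -> : flat m.+2 x - m%:R * flat m.+1 x = 0.
    by rewrite /flat ltNge (ltW x0) mulr0 subr0.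
  apply: (@near_eq_is_derive _ _ _ (cst 0)).
  near=> y; rewrite /flat ifF//; apply/negbTE; rewrite -leNgt ltW//.
  by near: y; exact: lt_nbhsl.
(* [flat m] is x |-> g (1/x) to the right of 0. *)
- pose g (z : R) := z ^+ m * expR (- z).
  apply: (@near_eq_is_derive R R R (g \o GRing.inv)).
    by near=> y; rewrite /flat ifT//; near: y; exact: lt_nbhsr.
  have dV : is_derive x 1 (@GRing.inv R) (- x^-1 ^+ 2).
    apply: is_derive_eq (is_deriveV (f := id) _ (is_derive_id x 1)) _.
      by rewrite gt_eqF.
    by rewrite [_ *: _]mulr1 exprVn.
  have dX (z : R) : is_derive z 1 (fun z : R => z ^+ m) (m%:R * z ^+ m.-1).
    apply: DeriveDef; first exact: exprn_derivable.
    by rewrite exp_derive [_ *: _]mulr1.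
  have dE (z : R) : is_derive z 1 (fun z => expR (- z)) (- expR (- z)).
    by apply: is_derive_eq; rewrite mulrN1.
  have dg (z : R) : is_derive z 1 g (z ^+ m * (- expR (- z)) +
      expR (- z) * (m%:R * z ^+ m.-1)).
    exact: is_deriveM.
  apply: is_derive_eq (is_derive1_comp (dg _) dV) _.
  rewrite /flat x0; case: (m) => [|k] /=; rewrite ?exprS; ring.
- have -> : flat m.+2 0 - m%:R * flat m.+1 0 = 0 :> R.
    by rewrite /flat ltxx mulr0 subr0.
  suff h : (fun h =>
      h^-1 *: ((flat m \o shift 0) (h *: 1) - flat m 0)) @ 0^' --> (0 : R).
    by apply: DeriveDef; [apply/cvg_ex; exists 0|exact: cvg_lim].
  set C := m.+2`!%:R : R.
  have hC : C * `|h| @[h --> (0 : R)^'] --> (0 : R).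
    rewrite -[X in _ --> X](mulr0 C); apply: cvgM; first exact: cvg_cst.
    rewrite -[X in _ --> X](@normr0 _ R); apply: cvg_norm.
    exact: cvg_within.
  apply/norm_cvg0P; apply: squeeze_cvgr (cvg_cst 0) hC.
  near=> h; rewrite normr_ge0 /= /shift /= addr0 [h *: 1]mulr1.
  have h0 : h != 0 by near: h; exact: nbhs_dnbhs_neq.
  rewrite {2}/flat ltxx subr0 normrZ normfV ler_pdivrMl ?normr_gt0//.
  rewrite (le_trans (flat_le m h))// [leRHS]mulrCA -expr2 real_normK ?num_real.
Unshelve. all: by end_near. Qed.

Lemma Ck_on_flat (k m : nat) : Ck_on k [set: R] (flat m : R -> R).
Proof.
have dflat j x : differentiable (flat j) x.
  by apply/derivable1_diffP; have [] := is_derive_flat j x.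
elim: k m => [|k IHk] m /=; first by move=> x _; exact/differentiable_continuous.
split=> // v.
have -> : (fun x => 'D_v (flat m) x) =
    cst v * (flat m.+2 + cst (- m%:R) * flat m.+1).
  apply/funext => x; rewrite deriveE// -[v in LHS]mulr1 linearZ/= -deriveE//.
  by have [_ ->] := is_derive_flat m x; rewrite !fctE mulNr.
by do !(apply: Ck_onM || apply: Ck_onD || exact: Ck_on_cst ||
  exact: IHk || exact: openT).
Qed.

End flat.

(** * Bump functions on R^n *)

Section bump.
Variables (R : realType) (n : nat).
Implicit Types (a : 'rV[R]_n) (r : R).

(** The Euclidean distance is used because its square is a polynomial, while the
    ambient norm is the maximum norm. *)
Definition sqdist a (x : 'rV[R]_n) : R := \sum_(i < n) (x 0 i - a 0 i) ^+ 2.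

Definition smooth_bump a r (x : 'rV[R]_n) : R := flat 0 (r ^+ 2 - sqdist a x).

Lemma sqdistxx a : sqdist a a = 0.
Proof. by apply: big1 => i _; rewrite subrr expr0n. Qed.

Lemma sqdist_eq0 a x : sqdist a x = 0 -> x = a.
Proof.
move=> /eqP; rewrite psumr_eq0 => [/allP d0|i _]; last exact: sqr_ge0.
apply/rowP => i; have := d0 i (mem_index_enum _).
by rewrite sqrf_eq0 subr_eq0 => /eqP.
Qed.

Lemma Ck_on_smooth_bump k (U : set 'rV[R]_n) a r : open U ->
  Ck_on k U (smooth_bump a r : 'rV[R]_n -> R).
Proof.
move=> oU.
apply: (@Ck_on_comp_real _ _ _ U setT _ _ oU _ _ (@Ck_on_flat _ _ 0)) => //.
pose s i : 'rV[R]_n -> R := coordinate i + cst (- a 0 i).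
have -> : (fun x => r ^+ 2 - sqdist a x) =
    cst (r ^+ 2) + cst (-1) * (\sum_(i < n) (s i * s i)).
  apply/funext => x; rewrite /sqdist !fctE fct_sumE mulN1r; congr (_ - _).
have cs i : Ck_on k U (s i).
  apply: Ck_onD => //; last exact: Ck_on_cst.
  apply: (@Ck_on_linear _ _ _ _ _ _ (@idfun 'rV[R]_n) (coordinate i)) => //.
    exact: continuous_coordinate.
  exact: Ck_on_id.
apply: Ck_onD => //; first exact: Ck_on_cst.
apply: Ck_onM => //; first exact: Ck_on_cst.
by apply: Ck_on_sum => // i; exact: Ck_onM.
Qed.

Lemma smooth_bump_center_gt0 a r : 0 < r -> 0 < smooth_bump a r a.
Proof.
move=> r0; rewrite /smooth_bump sqdistxx subr0 /flat exprn_gt0// expr0 mul1r.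
exact: expR_gt0.
Qed.

(** The flat function is strictly increasing on the positive reals, so the bump
    attains its maximum only at the center; this is what makes it separate its
    center from every other point. *)
Lemma smooth_bump_max a r x : 0 < r ->
  smooth_bump a r x = smooth_bump a r a -> x = a.
Proof.
move=> r0 xa; have := smooth_bump_center_gt0 a r0; rewrite -xa => x0.
apply: sqdist_eq0; move: xa x0; rewrite /smooth_bump sqdistxx subr0 /flat.
rewrite exprn_gt0//; case: ifPn => [_|]; last by rewrite ltxx.
rewrite !expr0 !mul1r => /expR_inj /oppr_inj /invr_inj + _.
by move=> /eqP; rewrite -subr_eq0 addrAC subrr add0r oppr_eq0 => /eqP.
Qed.

Lemma smooth_bump_out a r x :
  0 < r -> ~ closed_ball a r x -> smooth_bump a r x = 0.
Proof.
move=> r0 nx; rewrite /smooth_bump /flat ifF//; apply/negbTE; apply/negP => sr.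
apply: nx; rewrite closed_ballE// /closed_ball_ /=.
rewrite [leLHS]/Num.Def.normr/= mx_normrE bigmax_le ?ltW// => -[i j] _ /=.
rewrite ord1 !mxE distrC -ler_sqr ?nnegrE ?(ltW r0)//.
rewrite real_normK ?num_real//; move: sr; rewrite subr_gt0 => /ltW.
apply: le_trans.
by rewrite /sqdist (bigD1 j)//= lerDl; apply: sumr_ge0 => *; exact: sqr_ge0.
Qed.

End bump.

(** * Charts and transition maps *)

Section charts.
Variables (R : realType) (n : nat) (M : manifold R n).
Implicit Types (c : chart R n M) (p q : M).

Lemma image_dom c (A : set M) :
  phi c @` (dom c `&` A) = phi c @` dom c `&` psi c @^-1` A.
Proof.
apply/seteqP; split=> [x [q [cq Aq] <-]|x [[q cq <-]]] /=.
  by split; [exists q|rewrite phiK].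
by rewrite phiK// => Aq; exists q.
Qed.

Lemma open_image_dom c (A : set M) : open A -> open (phi c @` (dom c `&` A)).
Proof.
move=> oA; rewrite image_dom openE => x [cx Ax]; apply: filterI.
  by apply: open_nbhs_nbhs; split=> //; exact: open_cod.
by apply: (psi_continuous cx); exact: open_nbhs_nbhs.
Qed.

Lemma near_dom c q : dom c q -> \forall x \near phi c q, phi c (psi c x) = x.
Proof.
move=> cq; near=> x.
have [z cz <-] : (phi c @` dom c) x.
  by near: x; apply: open_nbhs_nbhs; split; [exact: open_cod|exists q].
by rewrite phiK.
Unshelve. all: by end_near. Qed.

Lemma near_psi c q (A : set M) : dom c q -> nbhs q A ->
  \forall x \near phi c q, A (psi c x).
Proof.
move=> cq Aq; have cod : (phi c @` dom c) (phi c q) by exists q.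
by apply: (psi_continuous cod); rewrite phiK.
Qed.

Lemma nbhs_dom c q : dom c q -> nbhs q (dom c).
Proof. by move=> cq; apply: open_nbhs_nbhs; split=> //; exact: open_dom. Qed.

Lemma differentiable_transition c c' q : atlas c -> atlas c' -> dom c q ->
  dom c' q -> differentiable (phi c' \o psi c) (phi c q).
Proof.
move=> ac ac' cq cq'; have [d _] := atlas_compatible ac ac' 1%N.
by apply: d; exists q.
Qed.

(** The chain rule for transition maps: the components of a tangent vector do
    not depend on the chart through which they are computed. *)
Lemma diff_transition_comp c1 c2 c3 q (v : 'rV[R]_n) :
  atlas c1 -> atlas c2 -> atlas c3 -> dom c1 q -> dom c2 q -> dom c3 q ->
  'd (phi c3 \o psi c2) (phi c2 q) ('d (phi c2 \o psi c1) (phi c1 q) v) =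
  'd (phi c3 \o psi c1) (phi c1 q) v.
Proof.
move=> a1 a2 a3 q1 q2 q3.
have d12 : differentiable (phi c2 \o psi c1) (phi c1 q).
  exact: differentiable_transition.
have d13 : differentiable (phi c3 \o psi c1) (phi c1 q).
  exact: differentiable_transition.
have d23 : differentiable (phi c3 \o psi c2) ((phi c2 \o psi c1) (phi c1 q)).
  by rewrite /= phiK//; exact: differentiable_transition.
have d123 := differentiable_comp d12 d23.
rewrite -[RHS](deriveE _ d13).
have e : \forall x \near phi c1 q,
    ((phi c3 \o psi c2) \o (phi c2 \o psi c1)) x =
    (phi c3 \o psi c1) x.
  near=> x; rewrite /= (@phiK _ _ _ c2)//.
  by near: x; apply: near_psi => //; exact: nbhs_dom.
have chain := congr1 (@^~ v) (diff_comp d12 d23).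
have q21 : (phi c2 \o psi c1) (phi c1 q) = phi c2 q by rewrite /= phiK.
rewrite -(near_eq_derive _ e) (deriveE _ d123); apply/esym.
apply: etrans chain _; cbn beta; rewrite q21; reflexivity.
Unshelve. all: by end_near. Qed.

Lemma diff_transition_id c q (v : 'rV[R]_n) : atlas c -> dom c q ->
  'd (phi c \o psi c) (phi c q) v = v.
Proof.
move=> ac cq; have d : differentiable (phi c \o psi c) (phi c q).
  exact: differentiable_transition.
rewrite -(deriveE _ d) (@near_eq_derive _ _ _ _ id) ?derive_id//.
exact: near_dom.
Qed.

End charts.

(** * Extension by zero from a chart *)

Section extension_by_zero.
Variables (R : realType) (n : nat) (M : manifold R n).
Variables (c0 : chart R n M) (a : 'rV[R]_n) (r : R).
Hypotheses (ac0 : atlas c0) (r0 : 0 < r).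
Hypothesis ball_cod : closed_ball a r `<=` phi c0 @` dom c0.

Let K : set M := psi c0 @` closed_ball a r.

(** A compact subset of a chart is closed in the whole manifold because the
    manifold is Hausdorff. *)
Lemma closed_support : closed K.
Proof.
apply: compact_closed; first exact: manifold_hausdorff.
apply: continuous_compact.
  apply: continuous_in_subspaceT => x; rewrite inE => /ball_cod.
  exact: psi_continuous.
apply: bounded_closed_compact; last exact: closed_ball_closed.
exists (`|a| + r); split; first exact: num_real.
move=> N rN x; rewrite closed_ballE// /closed_ball_ /= => xr.
rewrite -[x](subKr a) (le_trans (ler_normB _ _))// (le_trans _ (ltW rN))//.
by rewrite lerD2l.
Qed.

Lemma support_dom : K `<=` dom c0.
Proof. by move=> q [x /ball_cod[z cz <-]] <-; rewrite phiK. Qed.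

(** [f] is the expression in the chart [c] of an object which is described by
    [g] in the chart [c0] and vanishes off the compact set [K]. The two open
    sets [dom c0] and the complement of [K] cover the manifold. *)
Lemma smooth_extension (c : chart R n M) (f g : 'rV[R]_n -> R) : atlas c ->
  smooth_on (phi c0 @` (dom c0 `&` dom c)) g ->
  (forall x, (phi c @` (dom c `&` dom c0)) x -> f x = g (phi c0 (psi c x))) ->
  (forall x, (phi c @` dom c) x -> ~ K (psi c x) -> f x = 0) ->
  smooth_on (phi c @` dom c) f.
Proof.
move=> ac sg fg f0 k; apply: Ck_on_bigcup => x cx.
have [c0x|nc0x] := pselect (dom c0 (psi c x)).
  exists (phi c @` (dom c `&` dom c0)); first by rewrite image_dom.
  have oU : open (phi c @` (dom c `&` dom c0)) by exact/open_image_dom/open_dom.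
  apply: (@Ck_on_eq _ _ _ _ _ (g \o (phi c0 \o psi c))) => // [y /fg ->//|].
  apply: Ck_on_comp_rV (sg k) => //; last exact: atlas_compatible.
  by move=> y [q [cq c0q] <-] /=; rewrite phiK//; exists q.
exists (phi c @` (dom c `&` ~` K)).
  by rewrite image_dom; split=> // /support_dom.
apply: (@Ck_on_eq _ _ _ _ _ (cst 0)); last exact: Ck_on_cst.
  by apply: open_image_dom; apply: closed_openC; exact: closed_support.
move=> y; rewrite image_dom => -[cy Ky]; by rewrite f0.
Qed.

End extension_by_zero.

(** * Global functions and vector fields *)

Section global_objects.
Variables (R : realType) (n : nat) (M : manifold R n).
Implicit Types (p q : M).

Lemma closed_ball_in_chart (c : chart R n M) p : dom c p ->
  exists2 r, 0 < r & closed_ball (phi c p) r `<=` phi c @` dom c.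
Proof.
move=> cp; have /nbhs_closedballP[r rc] : nbhs (phi c p) (phi c @` dom c).
  by apply: open_nbhs_nbhs; split; [exact: open_cod|exists p].
by exists r%:num.
Qed.

(** A bump function centered at [p], read in a chart. *)
Lemma separating_function p :
  exists G : smooth_function M, forall q, G q = G p -> q = p.
Proof.
have ac0 := chart_at_atlas p; have c0p := dom_chart_at p.
set c0 := chart_at p in ac0 c0p.
have [r r0 rc] := closed_ball_in_chart c0p.
pose h q : R := if q \in dom c0 then smooth_bump (phi c0 p) r (phi c0 q) else 0.
have sh c : atlas c -> smooth_on (W := R) (phi c @` dom c) (h \o psi c).
  move=> ac; apply: (smooth_extension ac0 r0 rc ac
    (g := smooth_bump (phi c0 p) r)).
  - by move=> k; apply: Ck_on_smooth_bump; exact/open_image_dom/open_dom.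
  - by move=> x; rewrite image_dom => -[_ c0x]; rewrite /h /= mem_set.
  - move=> x _ nK; rewrite /h /=; case: ifPn => // /set_mem c0x.
    apply: smooth_bump_out => // xb; apply: nK; exists (phi c0 (psi c x)) => //.
    by rewrite phiK.
exists (SmoothFunction sh) => q; rewrite /= /h (mem_set c0p).
case: ifPn => [/set_mem c0q /(smooth_bump_max r0) qp|_ /esym/eqP].
  by rewrite -(phiK c0q) qp phiK.
by rewrite gt_eqF// smooth_bump_center_gt0.
Qed.

(** Multiply the field which is constant in a chart by a bump function. The
    gradients are only specified by pairing with global fields, so this is what
    turns a global identity into one about every tangent vector. *)
Lemma tangent_extension p (w : tangent p) : exists X : vector_field M, X p = w.
Proof.
have ac0 := chart_at_atlas p; have c0p := dom_chart_at p.
set c0 := chart_at p in ac0 c0p.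
have [r r0 rc] := closed_ball_in_chart c0p.
(* Normalized so that the field has the value [w] at [p] itself. *)
pose u : 'rV[R]_n := (smooth_bump (phi c0 p) r (phi c0 p))^-1 *: w.
pose h q : tangent q := if q \in dom c0 then
  'd (phi (chart_at q) \o psi c0) (phi c0 q)
    (smooth_bump (phi c0 p) r (phi c0 q) *: u) else 0.
have sh c : atlas c ->
    smooth_on (phi c @` dom c) (fun x => components c (h (psi c x))).
  move=> ac k; apply: Ck_on_rV; first exact: open_cod.
  move=> i; move: k.
  apply: (smooth_extension ac0 r0 rc ac (g := smooth_bump (phi c0 p) r *
    (coordinate i \o (fun x => 'D_u (phi c \o psi c0) x)))).
  - have oU : open (phi c0 @` (dom c0 `&` dom c)).
      by apply: open_image_dom; exact: open_dom.
    move=> k; apply: Ck_onM => //; first exact: Ck_on_smooth_bump.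
    apply: Ck_on_linear => //; first exact: continuous_coordinate.
    by have [_] := atlas_compatible ac0 ac k.+1; apply.
  - move=> x; rewrite image_dom => -[cx c0x].
    rewrite /= /components /h mem_set//.
    have cq : dom c (psi c x) by case: cx => q cq <-; rewrite phiK.
    rewrite diff_transition_comp//;
      [|exact: chart_at_atlas|exact: dom_chart_at].
    have dt := differentiable_transition ac0 ac c0x cq.
    by rewrite linearZ /= -(deriveE u dt) /coordinate !mxE.
  - move=> x _ nK; have hx : h (psi c x) = 0.
      rewrite /h; case: ifPn => // /set_mem c0x.
      have -> : smooth_bump (phi c0 p) r (phi c0 (psi c x)) = 0.
        apply: smooth_bump_out => // xb; apply: nK.
        by exists (phi c0 (psi c x)) => //; rewrite phiK.
      by rewrite scale0r linear0.
    by rewrite /= hx /components linear0 /coordinate mxE.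
exists (VectorField sh); rewrite /= /h mem_set// diff_transition_id//.
by rewrite /u scalerA divff ?scale1r// gt_eqF// smooth_bump_center_gt0.
Qed.

(** * Periodic orbits *)

Lemma is_derive_along_curve (F : smooth_function M) (X : vector_field M)
    (g : R -> M) (t : R) : integral_curve X g ->
  is_derive t (1 : R) (F \o g : R -> R) (differential F (X (g t))).
Proof.
move=> [cg dg]; have ac := chart_at_atlas (g t); have cgt := dom_chart_at (g t).
have {dg} := dg t; rewrite /differential.
set c := chart_at (g t) in ac cgt *; move=> [dgt Dgt].
have d1 : differentiable (phi c \o g) t by exact/derivable1_diffP.
have d2 : differentiable (F \o psi c : _ -> R) ((phi c \o g) t).
  by have [d _] := function_smooth F ac 1%N; apply: d; exists (g t).
have e : \forall s \near t, ((F \o psi c) \o (phi c \o g)) s = (F \o g) s.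
  near=> s; rewrite /= phiK//; near: s; apply: (cg t); exact: nbhs_dom.
apply: (near_eq_is_derive e).
have d12 := differentiable_comp d1 d2.
apply: DeriveDef; first exact: diff_derivable.
by rewrite (deriveE _ d12) (diff_comp d1 d2) /= -(deriveE _ d1) Dgt.
Unshelve. all: by end_near. Qed.

(** The sign-corrected function [s * F] is monotone and periodic along a
    periodic orbit, hence constant, whence the field vanishes along it. Every smooth
    function, in particular one separating [g 0] from all other points, is then
    constant along the orbit, which therefore stays at [g 0]. *)
Lemma no_periodic_orbit (F : smooth_function M) (X : vector_field M) (s : R) :
  (forall p, 0 <= s * differential F (X p)) ->
  (forall p, s * differential F (X p) = 0 -> X p = 0) ->
  ~ exists g, nontrivial_periodic_orbit X g.
Proof.
move=> X_ge0 X_eq0 [g [gX [T T0 gT] []]]; exists (g 0).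
pose h t := s * F (g t).
have dh (t : R) : is_derive t (1 : R) h (s * differential F (X (g t))).
  have dFg := is_derive_along_curve F t gX.
  exact: (is_deriveZ s dFg).
have h_ndecr t t' : t <= t' -> h t <= h t'.
  move=> tt'.
  apply: (@ger0_derive1_ndecr _ h t t') => // [x _|].
  - by rewrite derive1E; have [_ ->] := dh x.
  - by apply: derivable_within_continuous => x _; have [] := dh x.
have h_cst t : s * differential F (X (g t)) = 0.
  have [_ <-] := dh t.
  rewrite (@near_eq_derive _ _ _ _ (cst (h t))) ?derive_cst//.
  near=> x.
  have tx : t - T <= x <= t + T.
    by rewrite -ler_distlC ltW.
  (* h (t - T) <= h x <= h (t + T), and both bounds are h t. *)
  have hT y : h (y + T) = h y by rewrite /h gT.
  case/andP: tx => tx xt; apply/eqP; rewrite eq_le.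
  by rewrite -{1}(hT t) h_ndecr//= -[t in h t](subrK T) hT h_ndecr.
move=> t; have [G sepG] := separating_function (g 0); apply: sepG.
apply: (@is_derive_0_is_cst _ (G \o g)) => x.
apply: is_derive_eq (is_derive_along_curve G x gX) _.
by rewrite X_eq0// /differential linear0.
Unshelve. all: by end_near. Qed.

(** * Gradients of a definite bracket *)

Section gradients.
Variable b : geometric_structure M.

Lemma left_gradient_Crit (F : smooth_function M) (V : vector_field M) p :
  is_left_gradient b F V -> Crit F p -> V p = 0.
Proof.
move=> FV Fp; apply: (form_nondegl (g := b)) => w.
by have [X <-] := tangent_extension w; rewrite -[LHS]/(eval_form b V X p) FV Fp.
Qed.

Lemma right_gradient_Crit (F : smooth_function M) (V : vector_field M) p :
  is_right_gradient b F V -> Crit F p -> V p = 0.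
Proof.
move=> FV Fp; apply: (form_nondegr (g := b)) => w.
by have [X <-] := tangent_extension w; rewrite -[LHS]/(eval_form b X V p) FV Fp.
Qed.

Lemma definite_sign : positive_definite b \/ negative_definite b ->
  exists s : R, forall F p, ~ Crit F p -> 0 < s * bracket b F F p.
Proof.
case=> hb; [exists 1|exists (-1)] => F p /hb; first by rewrite mul1r.
by rewrite mulN1r oppr_gt0.
Qed.

Lemma no_periodic_gradient (F : smooth_function M) (V : vector_field M) :
  positive_definite b \/ negative_definite b ->
  (forall p, differential F (V p) = bracket b F F p) ->
  (forall p, Crit F p -> V p = 0) ->
  ~ exists g, nontrivial_periodic_orbit V g.
Proof.
move=> /definite_sign[s hs] FV V0.
apply: (@no_periodic_orbit F V s) => p; rewrite FV.
  have [Fp|/hs/ltW//] := pselect (Crit F p).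
  by rewrite -FV Fp mulr0.
move=> b0; apply: V0; apply: contrapT => /hs.
by rewrite b0 ltxx.
Qed.

Lemma left_gradientP (F : smooth_function M) :
  is_left_gradient b F (left_gradient b F) \/ left_gradient b F = zero_field.
Proof.
by rewrite /left_gradient; case: xgetP => [V _ FV|_]; [left|right].
Qed.

Lemma right_gradientP (F : smooth_function M) :
  is_right_gradient b F (right_gradient b F) \/ right_gradient b F = zero_field.
Proof.
by rewrite /right_gradient; case: xgetP => [V _ FV|_]; [left|right].
Qed.

(** This is the case of the default value of a gradient. *)
Lemma zero_field_no_periodic_orbit (F : smooth_function M) :
  ~ exists g, nontrivial_periodic_orbit (zero_field : vector_field M) g.
Proof.
apply: (@no_periodic_orbit F zero_field 0) => p //.
by rewrite mul0r.
Qed.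

(** When both gradients exist, dF(RF) = b(LF, RF) = dF(LF) = b(LF, LF). If the
    left one did not exist, its default value 0 would make the bracket of [F]
    with itself vanish; definiteness then forces dF = 0 everywhere. *)
Lemma right_gradient_bracket (F : smooth_function M) (V : vector_field M) p :
  positive_definite b \/ negative_definite b ->
  is_right_gradient b F V -> differential F (V p) = bracket b F F p.
Proof.
move=> hb FV; have [FL|L0] := left_gradientP F.
  by rewrite -(FL V) (FV (left_gradient b F)) -FL.
have -> : bracket b F F p = 0.
  by rewrite /bracket L0 /= linear0l.
suff : Crit F p by apply.
have [s hs] := definite_sign hb; apply: contrapT => /hs.
by rewrite /bracket L0 /= linear0l mulr0 ltxx.
Qed.

End gradients.
End global_objects.

Theorem theorem6p8 (R : realType) (n : nat) (M : manifold R n)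
    (b : geometric_structure M)
    (hb : positive_definite b \/ negative_definite b)
    (F : smooth_function M) :
  (~ exists g : R -> M, nontrivial_periodic_orbit (left_gradient b F) g) /\
  (~ exists g : R -> M, nontrivial_periodic_orbit (right_gradient b F) g).
Proof.
split.
  have [FL|->] := left_gradientP b F; last exact: zero_field_no_periodic_orbit.
  apply: (no_periodic_gradient hb) => p; first exact/esym/FL.
  exact: left_gradient_Crit FL.
have [FR|->] := right_gradientP b F; last exact: zero_field_no_periodic_orbit.
apply: (no_periodic_gradient hb) => p; first exact: right_gradient_bracket.
exact: right_gradient_Crit FR.
Qed.
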